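(* Let $P$ be a poset on $\{1,2,\ldots,n\}$. There exists a bijection between the set $\mathscr{F}(P)$ of $P$-forests and the set $\mathscr{M}(G_P)$ of maximum independent sets of the graph $G_P$.
   Context: Let $\leq_P$ be a partial order on $[n]=\{1,\ldots,n\}$. An order ideal of $P$ is a subset $J\subseteq[n]$ such that $i\in J$ and $j\leq_P i$ imply $j\in J$. A (nonempty) order ideal $J$ is connected if the Hasse diagram of $P$ restricted to $J$ is a connected graph. Two sets $A,B$ intersect nontrivially if $A\cap B\neq\emptyset$, $A\not\subseteq B$ and $B\not\subseteq A$. The graph $G_P$ is the simple graph whose vertex set is the set of connected order ideals of $P$, two vertices being adjacent iff they intersect nontrivially. An independent set of a graph is a set of pairwise non-adjacent vertices; a maximum independent set is an independent set of largest possible size. For a poset $F$ on $[n]$ write $\Lambda_i^F=\{j : j\leq_F i\}$. A $P$-forest is a poset $F$ on $[n]$ that is a forest (every element is covered by at most one other element) such that for every $i$, $\Lambda_i^F$ is a connected order ideal of $P$, and for any two elements $i,j$ incomparable in $F$, the set $\Lambda_i^F\cup\Lambda_j^F$ is a disconnected order ideal of $P$. *)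

(* Defs.v *)
From HB Require Import structures.
From mathcomp Require Import all_boot.

Set Implicit Arguments.
Unset Strict Implicit.
Unset Printing Implicit Defensive.

(* The ground set [n] is 'I_n.  Orders are stored as finite functions, so that
   two posets are equal as soon as their order relations agree pointwise. *)

Definition porder_axiom n (r : rel 'I_n) : bool :=
  [&& [forall i, r i i],
      [forall i, forall j, r i j && r j i ==> (i == j)]
    & [forall i, forall j, forall k, r i j && r j k ==> r i k]].

Lemma porder_axiomP n (r : rel 'I_n) :
  reflect [/\ reflexive r, antisymmetric r & transitive r] (porder_axiom r).
Proof.
apply: (iffP and3P) => [[r1 r2 r3]|[r1 r2 r3]]; split.
- by move=> i; apply: (forallP r1).
- by move=> i j rij; apply/eqP; move: rij; apply/implyP/(forallP (forallP r2 i)).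
- move=> j i k rij rjk.
  by move/forallP/(_ i)/forallP/(_ j)/forallP/(_ k)/implyP: r3; apply; rewrite rij.
- by apply/forallP.
- by apply/forallP=> i; apply/forallP=> j; apply/implyP=> /r2/eqP.
- apply/forallP=> i; apply/forallP=> j; apply/forallP=> k.
  by apply/implyP=> /andP[]; apply: r3.
Qed.

Record poset (n : nat) := Poset {
  poset_le :> {ffun 'I_n -> {ffun 'I_n -> bool}};
  _ : porder_axiom (fun i j => poset_le i j) }.

HB.instance Definition _ n := [isSub for @poset_le n].
HB.instance Definition _ n := [Finite of poset n by <:].

Record sgraph := SGraph {
  vertex :> finType;
  adj : rel vertex;
  adj_sym : symmetric adj;
  adj_irrefl : irreflexive adj }.

Definition independent (G : sgraph) (S : {set G}) : bool :=
  [forall u in S, forall v in S, ~~ adj u v].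

Definition maximum_independent (G : sgraph) (S : {set G}) : bool :=
  independent S && [forall S' : {set G}, independent S' ==> (#|S'| <= #|S|)].

Definition max_indep_set (G : sgraph) := {S : {set G} | maximum_independent S}.

Section Poset.
Variables (n : nat) (P : poset n).
Implicit Types (i j : 'I_n) (J : {set 'I_n}).

Definition order_ideal J : bool :=
  [forall i in J, forall j, P j i ==> (j \in J)].

Definition poset_lt i j : bool := (i != j) && P i j.

(* [covers i j]: j covers i. *)
Definition covers i j : bool :=
  poset_lt i j && ~~ [exists k, poset_lt i k && poset_lt k j].

Definition hasse i j : bool := covers i j || covers j i.

Definition hasse_in J : rel 'I_n :=
  fun i j => [&& i \in J, j \in J & hasse i j].

Definition hasse_connected J : bool :=
  (J != set0) && [forall i in J, forall j in J, connect (hasse_in J) i j].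

Definition connected_ideal J : bool := order_ideal J && hasse_connected J.

Definition disconnected_ideal J : bool := order_ideal J && ~~ hasse_connected J.

Definition principal i : {set 'I_n} := [set j | P j i].

Definition is_forest : bool := [forall i, #|[set j | covers i j]| <= 1].

End Poset.

Definition intersect_nontrivially (T : finType) (A B : {set T}) : bool :=
  [&& A :&: B != set0, ~~ (A \subset B) & ~~ (B \subset A)].

Section IdealGraph.
Variables (n : nat) (P : poset n).

Definition conn_ideal := {J : {set 'I_n} | connected_ideal P J}.

Definition ideal_adj : rel conn_ideal :=
  fun A B => intersect_nontrivially (val A) (val B).

Lemma ideal_adj_sym : symmetric ideal_adj.
Proof.
move=> A B; rewrite /ideal_adj /intersect_nontrivially setIC.
by congr (_ && _); rewrite andbC.
Qed.

Lemma ideal_adj_irrefl : irreflexive ideal_adj.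
Proof. by move=> A; rewrite /ideal_adj /intersect_nontrivially subxx andbF. Qed.

Definition ideal_graph : sgraph := SGraph ideal_adj_sym ideal_adj_irrefl.

Definition is_pforest (F : poset n) : bool :=
  [&& is_forest F,
      [forall i, connected_ideal P (principal F i)]
    & [forall i, forall j, ~~ F i j && ~~ F j i ==>
         disconnected_ideal P (principal F i :|: principal F j)]].

Definition pforest := {F : poset n | is_pforest F}.

End IdealGraph.

(* Main.v *)
Require Import Defs.
From mathcomp Require Import all_boot.

Set Implicit Arguments.
Unset Strict Implicit.
Unset Printing Implicit Defensive.

(** An independent set [S] of [G_P] is a laminar family of connected ideals.
    Disjoint ideals have no Hasse edge between them, so each [J] in [S] has an
    own element, lying in no member of [S] properly contained in [J]; own
    elements of distinct members differ, hence [#|S| <= n].  The bound [n] is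
    attained: along a linear extension of [P], take for every [i] the component
    of [i] in the ideal of the elements not after [i].  So in a maximum
    independent set every [i] is the own element of exactly one member, which
    is the least member containing [i].  The bijection sends a forest to the
    family of its principal ideals; its inverse sends [S] to the order in which
    [j] is below [i] when every member of [S] containing [i] contains [j]. *)

(** * Order ideals and connectivity in the Hasse diagram *)

Section PosetTheory.
Variables (n : nat) (P : poset n).
Implicit Types (i j k x y z : 'I_n) (J K A B : {set 'I_n}).

Lemma poset_axioms : [/\ reflexive (fun i j => P i j),
  antisymmetric (fun i j => P i j) & transitive (fun i j => P i j)].
Proof. exact/porder_axiomP/(valP P). Qed.

Lemma poset_refl i : P i i.
Proof. by case: poset_axioms. Qed.

Lemma poset_anti i j : P i j -> P j i -> i = j.
Proof. by move=> ij ji; case: poset_axioms => _ anti _; apply: anti; rewrite ij. Qed.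

Lemma poset_trans j i k : P i j -> P j k -> P i k.
Proof. by case: poset_axioms => _ _; apply. Qed.

Lemma principal_id i : i \in principal P i.
Proof. by rewrite inE poset_refl. Qed.

Lemma principal_sub i j : (principal P i \subset principal P j) = P i j.
Proof.
apply/subsetP/idP => [/(_ i (principal_id i))|ij k]; first by rewrite inE.
by rewrite !inE => ki; apply: poset_trans ij.
Qed.

Lemma principal_inj : injective (principal P).
Proof. by move=> i j eij; apply: poset_anti; rewrite -principal_sub eij. Qed.

Lemma order_idealP J :
  reflect (forall i j, i \in J -> P j i -> j \in J) (order_ideal P J).
Proof.
apply: (iffP forall_inP) => idJ i.
  by move=> j iJ; apply: implyP; apply: (forallP (idJ i iJ)).
by move=> iJ; apply/forallP=> j; apply/implyP; apply: idJ.
Qed.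

Lemma hasse_sym : symmetric (hasse P).
Proof. by move=> i j; rewrite /hasse orbC. Qed.

Lemma hasse_in_sym J : symmetric (hasse_in P J).
Proof. by move=> i j; rewrite /hasse_in hasse_sym andbCA. Qed.

Lemma connect_hasse_sym J : connect_sym (hasse_in P J).
Proof. exact/sym_connect_sym/hasse_in_sym. Qed.

Lemma connect_hasse_sub A B i j : A \subset B ->
  connect (hasse_in P A) i j -> connect (hasse_in P B) i j.
Proof.
move=> /subsetP sAB; apply: connect_sub => x y /and3P[xA yA xy].
by apply: connect1; rewrite /hasse_in !sAB.
Qed.

(** Invariant principle for paths, used below with [K] as the part of [J] that no edge can leave. *)
Lemma connect_hasse_closed J K i j :
    (forall x y, x \in K -> hasse_in P J x y -> y \in K) ->
  i \in K -> connect (hasse_in P J) i j -> j \in K.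
Proof.
move=> clK iK /connectP[p + ->]; elim: p i iK => //= x p IHp i iK /andP[ix].
by apply: IHp; apply: clK ix.
Qed.

Lemma connect_hasse_mem J i j :
  i \in J -> connect (hasse_in P J) i j -> j \in J.
Proof. by apply: connect_hasse_closed => x y _ /and3P[]. Qed.

(** Induction on the size of the interval from [i] to [j]: either [j] covers [i], or an element
    strictly between splits the interval. The ideal [J] contains every element involved. *)
Lemma connect_hasse_le J i j : order_ideal P J -> j \in J -> P i j ->
  connect (hasse_in P J) i j.
Proof.
move=> /order_idealP idJ.
have [m] := ubnP #|[set k | P i k && P k j]|.
elim: m i j => // m IHm i j lt_m jJ ij.
have [->|neq_ij] := eqVneq i j; first exact: connect0.
have lt_ij : poset_lt P i j by rewrite /poset_lt neq_ij.
have [/existsP[k /andP[/andP[neq_ik ik] /andP[neq_kj kj]]]|ncov] :=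
  boolP [exists k, poset_lt P i k && poset_lt P k j]; last first.
  apply: connect1.
  by rewrite /hasse_in /hasse /covers lt_ij ncov jJ (idJ j i).
have kJ : k \in J by apply: idJ kj.
(* The lower interval misses [j] and the upper one misses [i]. *)
have [mk mkj] : #|[set x | P i x && P x k]| < m /\ #|[set x | P k x && P x j]| < m.
  split; (apply: leq_trans (lt_m : _ <= m); apply: proper_card);
    apply/properP; split.
  - apply/subsetP=> x; rewrite !inE => /andP[-> xk]; exact: poset_trans kj.
  - exists j; rewrite !inE ?ij ?poset_refl //=.
    by apply/negP=> jk; rewrite (poset_anti kj jk) eqxx in neq_kj.
  - by apply/subsetP=> x; rewrite !inE => /andP[kx ->]; rewrite (poset_trans ik).
  - exists i; rewrite !inE ?ij ?poset_refl //= andbT.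
    by apply/negP=> ki; rewrite (poset_anti ik ki) eqxx in neq_ik.
exact: connect_trans (IHm _ _ mk kJ ik) (IHm _ _ mkj jJ kj).
Qed.

Lemma hasse_connectedP J : reflect
  (J != set0 /\ {in J &, forall i j, connect (hasse_in P J) i j})
  (hasse_connected P J).
Proof.
apply: (iffP andP) => -[J0 cJ]; split=> //.
  by move=> i j iJ jJ; apply: (forall_inP (forall_inP cJ i iJ)).
by apply/forall_inP=> i iJ; apply/forall_inP=> j jJ; apply: cJ.
Qed.

Lemma hasse_connected_root J i : i \in J ->
  {in J, forall j, connect (hasse_in P J) i j} -> hasse_connected P J.
Proof.
move=> iJ ci; apply/hasse_connectedP; split=> [|j k jJ kJ].
  by apply/set0Pn; exists i.
by apply: connect_trans (ci k kJ); rewrite connect_hasse_sym ci.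
Qed.

Lemma order_idealU A B :
  order_ideal P A -> order_ideal P B -> order_ideal P (A :|: B).
Proof.
move=> /order_idealP idA /order_idealP idB; apply/order_idealP=> i j.
rewrite !inE => /orP[iA|iB] ji; apply/orP; first by left; apply: idA iA ji.
by right; apply: idB iB ji.
Qed.

Lemma hasse_connectedU A B : A :&: B != set0 ->
  hasse_connected P A -> hasse_connected P B -> hasse_connected P (A :|: B).
Proof.
move=> /set0Pn[x /setIP[xA xB]] /hasse_connectedP[_ cA] /hasse_connectedP[_ cB].
apply: (@hasse_connected_root _ x) => [|j]; first by rewrite inE xA.
case/setUP=> [jA|jB].
  exact: connect_hasse_sub (subsetUl A B) (cA _ _ xA jA).
exact: connect_hasse_sub (subsetUr A B) (cB _ _ xB jB).
Qed.

(** An edge joins comparable elements, and an ideal containing its upper end contains its lower end;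
    so an edge from [A] to [B] would give the two ideals a common element. *)
Lemma disjoint_ideals_disconnected A B : A != set0 -> B != set0 ->
    order_ideal P A -> order_ideal P B -> A :&: B = set0 ->
  ~~ hasse_connected P (A :|: B).
Proof.
move=> /set0Pn[a aA] /set0Pn[b bB] /order_idealP idA /order_idealP idB AB0.
have disAB x : x \in A -> x \in B -> False.
  by move=> xA xB; move: (in_set0 x); rewrite -AB0 inE xA xB.
apply/negP=> /hasse_connectedP[_ cAB]; apply: (disAB b) => //.
have: connect (hasse_in P (A :|: B)) a b by apply: cAB; rewrite inE ?aA ?bB ?orbT.
apply: connect_hasse_closed => // x y xA /and3P[_ yAB].
rewrite /hasse /covers /poset_lt => /orP[] /andP[/andP[_ le] _].
  by case/setUP: yAB => // yB; case: (disAB x) => //; apply: idB le.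
exact: idA le.
Qed.

(** * Connected components of ideals *)

Definition component J i : {set 'I_n} := [set j | connect (hasse_in P J) i j].

Lemma component_id J i : i \in component J i.
Proof. by rewrite inE connect0. Qed.

Lemma component_sub J i : i \in J -> component J i \subset J.
Proof. by move=> iJ; apply/subsetP=> j; rewrite inE; apply: connect_hasse_mem. Qed.

Lemma component_connected_ideal J i :
  order_ideal P J -> i \in J -> connected_ideal P (component J i).
Proof.
move=> idJ iJ; apply/andP; split.
  apply/order_idealP=> j k jC kj.
  have jJ := subsetP (component_sub iJ) j jC; move: jC; rewrite !inE => ij.
  by apply: connect_trans ij _; rewrite connect_hasse_sym connect_hasse_le.
apply: (hasse_connected_root (component_id J i)) => j.
rewrite inE => /connectP[p pth ->].
(* The path is followed from an arbitrary vertex [z] already reached from [i], so that each further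
   vertex is seen to stay in the component. *)
suff step z q : connect (hasse_in P J) i z -> path (hasse_in P J) z q ->
    connect (hasse_in P (component J i)) z (last z q).
  by apply: step pth; apply: connect0.
elim: q z => //= x q IHq z iz /andP[zx qth].
have ix : connect (hasse_in P J) i x := connect_trans iz (connect1 zx).
apply: connect_trans (IHq x ix qth); apply: connect1.
by case/and3P: zx => _ _ zx; rewrite /hasse_in !inE iz ix.
Qed.

(** Paths in [A] are paths in [B], so from one common element the whole component in [A] is reached
    inside [B]. *)
Lemma component_laminar A B i j : A \subset B ->
    component A i :&: component B j != set0 ->
  component A i \subset component B j.
Proof.
move=> sAB /set0Pn[z]; rewrite !inE => /andP[iz jz].
apply/subsetP=> w; rewrite !inE => iw; apply: connect_trans jz _.
apply: connect_hasse_sub sAB _; apply: connect_trans iw.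
by rewrite connect_hasse_sym.
Qed.

(* Breaking ties in the size of the principal ideals by the label makes
   [linext] a linear extension of [P] with values in [nat]. *)
Definition linext i : nat := #|principal P i| * n + i.

Lemma linext_inj : injective linext.
Proof.
(* Reduction modulo [n] recovers the label. *)
move=> i j /(congr1 (modn^~ n)); rewrite /linext !modnMDl !modn_small //.
exact: val_inj.
Qed.

Lemma linext_le i j : P i j -> linext i <= linext j.
Proof.
move=> ij; have [->//|neq_ij] := eqVneq i j.
have: #|principal P i| < #|principal P j|.
  apply: proper_card; rewrite properE !principal_sub ij /=.
  by apply: contra neq_ij => ji; rewrite (poset_anti ij ji).
(* The label [i] is below [n], so one more element in the principal ideal outweighs it. *)
move=> lt_ij; apply: leq_trans (leq_addr _ _).
apply: (@leq_trans (#|principal P i|.+1 * n)); last by rewrite leq_mul2r lt_ij orbT.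
by rewrite /linext mulSn addnC leq_add2r ltnW.
Qed.

Definition linext_ideal i : {set 'I_n} := [set j | linext j <= linext i].

Lemma linext_ideal_id i : i \in linext_ideal i.
Proof. by rewrite inE. Qed.

Lemma linext_ideal_order_ideal i : order_ideal P (linext_ideal i).
Proof.
by apply/order_idealP=> j k; rewrite !inE => ji /linext_le /leq_trans; apply.
Qed.

(** The element [i] is recovered from its component as the one with the largest [linext]. *)
Lemma linext_component_inj : injective (fun i => component (linext_ideal i) i).
Proof.
have le i j : component (linext_ideal i) i = component (linext_ideal j) j ->
    linext i <= linext j.
  move=> eC; have := component_id (linext_ideal i) i; rewrite eC.
  by move/(subsetP (component_sub (linext_ideal_id j))); rewrite inE.
by move=> i j eC; apply: linext_inj; apply/eqP; rewrite eqn_leq !le.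
Qed.

End PosetTheory.

(** * Own elements and the size of maximum independent sets *)

Section IndependentSets.
Variables (n : nat) (P : poset n).
Implicit Types (i j x : 'I_n) (J K : conn_ideal P) (S : {set ideal_graph P}).

Lemma conn_ideal_ideal J : order_ideal P (val J).
Proof. by case/andP: (valP J). Qed.

Lemma conn_ideal_connected J : hasse_connected P (val J).
Proof. by case/andP: (valP J). Qed.

Lemma conn_ideal_neq0 J : val J != set0.
Proof. by case/hasse_connectedP: (conn_ideal_connected J). Qed.

Lemma independentP S : reflect
  {in S &, forall J K, val J :&: val K != set0 ->
     (val J \subset val K) || (val K \subset val J)}
  (independent S).
Proof.
apply: (iffP forall_inP) => [indS J K JS KS JK|indS J JS].
  have /= := forall_inP (indS J JS) K KS.
  by rewrite /ideal_adj /intersect_nontrivially JK /= negb_and !negbK.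
apply/forall_inP=> K KS /=; rewrite /ideal_adj /intersect_nontrivially.
by apply/and3P=> -[JK nJK nKJ]; case/orP: (indS J K JS KS JK); apply/negP.
Qed.

Definition own S J x : bool :=
  (x \in val J) &&
  [forall K : conn_ideal P, (K \in S) && (val K \proper val J) ==> (x \notin val K)].

Lemma ownP S J x : reflect
  (x \in val J /\ forall K, K \in S -> val K \proper val J -> x \notin val K)
  (own S J x).
Proof.
apply: (iffP andP) => -[xJ ow]; split=> //.
  by move=> K KS KJ; apply: (implyP (forallP ow K)); rewrite KS.
by apply/forallP=> K; apply/implyP=> /andP[]; apply: ow.
Qed.

(* If every element of [J] were in a smaller member of [S], a largest such
   member [K] would be closed under Hasse edges within [J]. *)
Lemma own_exists S J : independent S -> J \in S -> exists x, own S J x.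
Proof.
move=> /independentP indS JS; apply/existsP; apply: contraT => /existsPn noown.
have sub x : x \in val J ->
    exists K : conn_ideal P, [&& K \in S, val K \proper val J & x \in val K].
  move=> xJ; have := noown x; rewrite /own xJ /= => /forallPn[K].
  by rewrite negb_imply negbK => /andP[/andP[KS KJ] xK]; exists K; rewrite KS KJ.
have [x xJ] := set0Pn _ (conn_ideal_neq0 J).
have [K0 K0P] := sub x xJ.
pose Q (K : conn_ideal P) := [&& K \in S, val K \proper val J & x \in val K].
case: (@arg_maxnP _ K0 Q (fun K => #|val K|) K0P) => K /and3P[KS KJ xK] maxK.
have /properP[_ [y yJ /negP[]]] := KJ.
have /hasse_connectedP[_ /(_ x y xJ yJ)] := conn_ideal_connected J.
apply: connect_hasse_closed (xK) => a b aK /and3P[aJ bJ].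
rewrite /hasse /covers /poset_lt => /orP[] /andP[/andP[_ le] _]; last first.
  exact: (order_idealP _ _ (conn_ideal_ideal K)) le.
(* Only an upward edge could leave [K]. A smaller member [L] containing [b] also contains [a], hence
   is nested with [K]; if it contains [K], maximality makes them equal. *)
have [L /and3P[LS LJ bL]] := sub b bJ.
have aL : a \in val L by apply: (order_idealP _ _ (conn_ideal_ideal L)) le.
have KL : val K :&: val L != set0 by apply/set0Pn; exists a; rewrite inE aK.
case/orP: (indS K L KS LS KL) => [sKL|/subsetP->//].
have /maxK le_LK : Q L by rewrite /Q LS LJ (subsetP sKL).
suff -> : val K = val L by [].
by apply/eqP; rewrite eqEcard sKL.
Qed.

(** The two members meet in [x], so they are nested, and ownership of [x] by [J] rules out [K] being
    properly inside [J]. *)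
Lemma own_least S J K x : independent S -> J \in S -> K \in S ->
  own S J x -> x \in val K -> val J \subset val K.
Proof.
move=> /independentP indS JS KS /ownP[xJ ow] xK.
have JK : val J :&: val K != set0 by apply/set0Pn; exists x; rewrite inE xJ.
have [//|sJK] := boolP (val J \subset val K).
have := indS J K JS KS JK; rewrite (negbTE sJK) /= => sKJ.
by have := ow K KS; rewrite properE sKJ sJK xK => /(_ isT).
Qed.

Lemma own_inj S J K x : independent S -> J \in S -> K \in S ->
  own S J x -> own S K x -> J = K.
Proof.
move=> indS JS KS Jx Kx; have [[xJ _] [xK _]] := (ownP _ _ _ Jx, ownP _ _ _ Kx).
apply/val_inj/eqP; rewrite eqEsubset.
by rewrite (own_least indS JS KS Jx xK) (own_least indS KS JS Kx xJ).
Qed.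

Definition pick_own S J : option 'I_n := [pick x | own S J x].

Lemma pick_ownP S J : independent S -> J \in S ->
  exists2 x, pick_own S J = Some x & own S J x.
Proof.
move=> indS JS; rewrite /pick_own; case: pickP => [x Jx|noown]; first by exists x.
by have [x] := own_exists indS JS; rewrite noown.
Qed.

Lemma pick_own_inj S : independent S -> {in S &, injective (pick_own S)}.
Proof.
move=> indS J K JS KS; have [x -> Jx] := pick_ownP indS JS.
have [y -> Ky] := pick_ownP indS KS => -[exy].
by apply: own_inj indS JS KS Jx _; rewrite exy.
Qed.

Lemma pick_own_sub S : independent S ->
  pick_own S @: S \subset [set Some x | x in [set: 'I_n]].
Proof.
move=> indS; apply/subsetP=> o /imsetP[J JS ->].
by have [x -> _] := pick_ownP indS JS; apply: imset_f.
Qed.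

Lemma card_some : #|[set Some x | x in [set: 'I_n]]| = n.
Proof. by rewrite card_imset ?cardsT ?card_ord // => x y []. Qed.

Lemma card_independent S : independent S -> #|S| <= n.
Proof.
move=> indS; rewrite -(card_in_imset (pick_own_inj indS)).
by rewrite -[leqRHS]card_some; apply/subset_leq_card/pick_own_sub.
Qed.

(** An injection between finite sets of equal size is onto. *)
Lemma pick_own_surj S i : independent S -> #|S| = n ->
  exists J : conn_ideal P, [/\ J \in S, pick_own S J = Some i & own S J i].
Proof.
move=> indS cardS; have: Some i \in pick_own S @: S.
  suff -> : pick_own S @: S = [set Some x | x in [set: 'I_n]] by apply: imset_f.
  apply/eqP; rewrite eqEcard pick_own_sub // card_some.
  by rewrite (card_in_imset (pick_own_inj indS)) cardS leqnn.
case/imsetP=> J JS; have [x eJ Jx] := pick_ownP indS JS; rewrite eJ => -[->].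
by exists J.
Qed.

Lemma independent_card_n : exists2 S : {set ideal_graph P}, independent S & #|S| = n.
Proof.
pose C i : conn_ideal P := exist (connected_ideal P) _
  (component_connected_ideal (linext_ideal_order_ideal P i) (linext_ideal_id P i)).
exists [set C i | i in [set: 'I_n]]; last first.
  rewrite card_imset ?cardsT ?card_ord // => i j /(congr1 val).
  exact: linext_component_inj.
apply/independentP=> _ _ /imsetP[i _ ->] /imsetP[j _ ->] /= CC.
(* The ideals [linext_ideal] form a chain, so [component_laminar] applies to any two of them in one
   order or the other. *)
have mono a b : linext P a <= linext P b -> linext_ideal P a \subset linext_ideal P b.
  by move=> ab; apply/subsetP=> x; rewrite !inE => /leq_trans; apply.
have [ij|/ltnW ji] := leqP (linext P i) (linext P j).
  by rewrite component_laminar ?mono.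
by rewrite orbC component_laminar ?mono // setIC.
Qed.

(** Replaces the comparison with all independent sets by a count, from which every element gets an
    owner. *)
Lemma maximum_independentE S :
  maximum_independent S = independent S && (#|S| == n).
Proof.
apply/andP/andP => -[indS].
  move=> /forallP maxS; split=> //; rewrite eqn_leq card_independent //.
  have [S' indS' cardS'] := independent_card_n.
  by rewrite -[leqLHS]cardS' (implyP (maxS S')).
move=> /eqP->; split=> //; apply/forallP=> S'; apply/implyP.
exact: card_independent.
Qed.

End IndependentSets.

(** * The two maps between forests and independent sets *)

Section ForestsAndIndependentSets.
Variables (n : nat) (P : poset n).
Implicit Types (i j : 'I_n) (F : poset n) (S : {set ideal_graph P}).

Definition principal_family F : {set ideal_graph P} :=
  [set J : conn_ideal P | [exists i, val J == principal F i]].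

Lemma principal_familyP F (J : conn_ideal P) :
  reflect (exists i, val J = principal F i) (J \in principal_family F).
Proof.
rewrite inE; apply: (iffP existsP) => -[i]; first by move/eqP=> eJ; exists i.
by move=> eJ; exists i; apply/eqP.
Qed.

(** Principal ideals of incomparable elements are disjoint, since the union of two meeting connected
    sets is connected. The family is thus laminar, and it has [n] members because [principal] is
    injective. *)
Lemma pforest_maximum F :
  is_pforest P F -> maximum_independent (principal_family F).
Proof.
move=> /and3P[_ /forallP conF /forallP disF].
rewrite maximum_independentE; apply/andP; split.
  apply/independentP=> J K /principal_familyP[i ei] /principal_familyP[j ej].
  rewrite ei ej !principal_sub => ij; apply: contraT; rewrite negb_or => inc.
  case/andP: (implyP (forallP (disF i) j) inc) => _ /negP[].
  by apply: hasse_connectedU => //; rewrite -?ei -?ej conn_ideal_connected.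
pose C i : conn_ideal P := exist (connected_ideal P) _ (conF i).
have -> : principal_family F = [set C i | i in [set: 'I_n]].
  apply/setP=> J; apply/principal_familyP/imsetP => [[i ei]|[i _ ->]].
    by exists i => //; apply: val_inj.
  by exists i.
rewrite card_imset ?cardsT ?card_ord // => i j /(congr1 val).
exact: principal_inj.
Qed.

Definition family_le S : {ffun 'I_n -> {ffun 'I_n -> bool}} :=
  [ffun j => [ffun i => [forall J : conn_ideal P,
     (J \in S) && (i \in val J) ==> (j \in val J)]]].

Lemma family_leP S j i : reflect
  (forall J : conn_ideal P, J \in S -> i \in val J -> j \in val J)
  (family_le S j i).
Proof.
rewrite !ffunE; apply: (iffP forallP) => le J.
  by move=> JS iJ; apply: (implyP (le J)); rewrite JS.
by apply/implyP=> /andP[]; apply: le.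
Qed.

Lemma family_le_own S (J : conn_ideal P) i j :
  independent S -> J \in S -> own S J i -> family_le S j i = (j \in val J).
Proof.
move=> indS JS Ji; have [iJ _] := ownP _ _ _ Ji.
apply/family_leP/idP => [/(_ J JS iJ)//|jJ K KS iK].
exact: (subsetP (own_least indS JS KS Ji iK)).
Qed.

(** For antisymmetry, elements in the same members of [S] own the same member; as every element is
    the picked own element of a member it owns, they coincide. *)
Lemma family_le_porder S : maximum_independent S ->
  porder_axiom (fun i j => family_le S i j).
Proof.
rewrite maximum_independentE => /andP[indS /eqP cardS].
apply/porder_axiomP; split.
- by move=> i; apply/family_leP.
- move=> i j /andP[/family_leP ij /family_leP ji].
  have [J [JS pJ Ji]] := pick_own_surj i indS cardS.
  have [K [KS pK Kj]] := pick_own_surj j indS cardS.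
  have [[iJ _] [jK _]] := (ownP _ _ _ Ji, ownP _ _ _ Kj).
  have eJK : J = K.
    apply/val_inj/eqP; rewrite eqEsubset (own_least indS JS KS Ji (ij K KS jK)).
    exact: own_least indS KS JS Kj (ji J JS iJ).
  by move: pJ; rewrite eJK pK => -[].
- move=> j i k /family_leP ij /family_leP jk.
  by apply/family_leP=> J JS kJ; apply: ij (jk J JS kJ).
Qed.

Definition family_poset S (maxS : maximum_independent S) : poset n :=
  Poset (family_le_porder maxS).

Lemma principal_family_poset S (maxS : maximum_independent S) (J : conn_ideal P) i :
  J \in S -> own S J i -> principal (family_poset maxS) i = val J.
Proof.
move=> JS Ji; apply/setP=> j; rewrite inE /=.
have := maxS; rewrite maximum_independentE => /andP[indS _].
exact: family_le_own.
Qed.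

Lemma family_poset_pforest S (maxS : maximum_independent S) :
  is_pforest P (family_poset maxS).
Proof.
have := maxS; rewrite maximum_independentE => /andP[indS /eqP cardS].
set F := family_poset maxS.
have ownJ i : exists2 J : conn_ideal P, J \in S & principal F i = val J.
  have [J [JS _ Ji]] := pick_own_surj i indS cardS.
  by exists J => //; apply: principal_family_poset.
have cmp i j : principal F i :&: principal F j != set0 -> F i j || F j i.
  have [J JS eJ] := ownJ i; have [K KS eK] := ownJ j.
  rewrite -!principal_sub eJ eK; exact: (independentP _ indS).
apply/and3P; split.
- apply/forallP=> i; apply/card_le1_eqP=> j k; rewrite !inE.
  move=> /andP[/andP[ij Fij] /existsPn nj] /andP[/andP[ik Fik] /existsPn nk].
  apply: contraTeq isT => neq_kj.
  (* Two principal ideals that share [i] are nested. Of two distinct upper covers of [i], one would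
     then lie strictly between [i] and the other. *)
  have /orP[jk|kj] : F j k || F k j.
    by apply: cmp; apply/set0Pn; exists i; rewrite !inE Fij.
  + by have := nk j; rewrite /poset_lt ij Fij eq_sym neq_kj jk.
  + by have := nj k; rewrite /poset_lt ik Fik neq_kj kj.
- by apply/forallP=> i; have [J _ ->] := ownJ i; apply: (valP J).
- apply/forallP=> i; apply/forallP=> j; apply/implyP=> inc.
  have dis : principal F i :&: principal F j = set0.
    by apply/eqP; apply: contraTT inc => /cmp; rewrite -negb_or negbK.
  move: dis; have [J _ ->] := ownJ i; have [K _ ->] := ownJ j => dis.
  rewrite /disconnected_ideal order_idealU ?conn_ideal_ideal //=.
  by rewrite disjoint_ideals_disconnected ?conn_ideal_neq0 ?conn_ideal_ideal.
Qed.

(** Among the principal ideals containing [i], the one of [i] itself is the least. *)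
Lemma principal_familyK F : is_pforest P F ->
  family_le (principal_family F) = poset_le F.
Proof.
move=> /and3P[_ /forallP conF _]; apply/ffunP=> j; apply/ffunP=> i.
apply/family_leP/idP => [le|ji J /principal_familyP[k ->]].
  pose C : conn_ideal P := exist (connected_ideal P) _ (conF i).
  have CF : C \in principal_family F by apply/principal_familyP; exists i.
  by have := le C CF (principal_id F i); rewrite inE.
by rewrite !inE; apply: poset_trans.
Qed.

(** Every element has an owner, so each principal ideal is a member of [S]; every member owns an
    element, so each member is principal. *)
Lemma family_posetK S (maxS : maximum_independent S) :
  principal_family (family_poset maxS) = S.
Proof.
have := maxS; rewrite maximum_independentE => /andP[indS /eqP cardS].
apply/setP=> J; apply/principal_familyP/idP => [[i]|JS].
  have [K [KS _ Ki]] := pick_own_surj i indS cardS.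
  by rewrite (principal_family_poset _ KS Ki) => /val_inj->.
have [i Ji] := own_exists indS JS.
by exists i; rewrite (principal_family_poset _ JS Ji).
Qed.

End ForestsAndIndependentSets.

Theorem theorem1p1 (n : nat) (P : poset n) :
  exists f : pforest P -> max_indep_set (ideal_graph P), bijective f.
Proof.
exists (fun F => exist (@maximum_independent (ideal_graph P)) _ (pforest_maximum (valP F))).
exists (fun S => exist (is_pforest P) _ (family_poset_pforest (valP S))) => [F|S].
  (* One [val_inj] strips the forest condition, the other the order axioms. *)
  do 2![apply: val_inj]; exact: principal_familyK (valP F).
by apply: val_inj; apply: family_posetK.
Qed.
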